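(* Let $S$ be an arbitrary proper sampling with average minibatch size $b=\mathrm{E}|S|$, let $v$ satisfy $\mathbf{P}-pp^\top\preceq \mathrm{Diag}(p_1v_1,\dots,p_nv_n)$, and let $\alpha$ be the associated quantity defined in the context. Consider one outer loop of SARAH with arbitrary sampling, started at $x^0$, with inner loop length $m$ and step size $\eta>0$ satisfying $$\eta\le\frac{2}{\bar L\left(\sqrt{1+\frac{4\alpha m}{b}}+1\right)}.$$ Then the output $x_a$ satisfies $$\mathrm{E}\|\nabla f(x_a)\|^2\le\frac{2}{\eta(m+1)}[f(x^0)-f(x^* )].$$ Thus, to obtain an $\epsilon$-accurate solution (with suitable $m$ and $\eta$), one needs $$n+\frac{16\alpha\bar L^2(f(x^0)-f(x^* ))^2}{2\epsilon^2}+\frac{\sqrt{16^2\alpha^2\bar L^4(f(x^0)-f(x^* ))^4+16\epsilon^2\bar L^2(f(x^0)-f(x^* ))^2b^2}}{2\epsilon^2}$$ stochastic gradient evaluations.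
   Context: Problem: $f(x)=\frac1n\sum_{i=1}^n f_i(x)$ with $f_i:\mathbb{R}^d\to\mathbb{R}$ differentiable, $L_i$-smooth ($\|\nabla f_i(x)-\nabla f_i(y)\|\le L_i\|x-y\|$ for all $x,y$), not necessarily convex; $f$ has a minimizer $x^*$; $\bar L=\frac1n\sum_{i=1}^n L_i>0$. A random point $x_a$ is $\epsilon$-accurate if $\mathrm{E}\|\nabla f(x_a)\|^2\le\epsilon$. Sampling: a sampling $S$ is a random subset of $[n]=\{1,\dots,n\}$; $\mathbf{P}_{ij}=\mathrm{Prob}(\{i,j\}\subseteq S)$ is its probability matrix, $p_i=\mathrm{Prob}(i\in S)$, $p=(p_1,\dots,p_n)^\top$; $S$ is proper if $p_i>0$ for all $i$; $b=\mathrm{E}|S|=\sum_i p_i$. For $v\in\mathbb{R}^n$ with $\mathbf{P}-pp^\top\preceq\mathrm{Diag}(p_1v_1,\dots,p_nv_n)$ set $K=\frac{b}{n^2}\sum_{i=1}^n\frac{v_iL_i^2}{p_i}$ and $\alpha=K/\bar L^2$. One outer loop of SARAH with arbitrary sampling from $x^0$: $v^0=\frac1n\sum_{i=1}^n\nabla f_i(x^0)$, $x^1=x^0-\eta v^0$; for $t=1,\dots,m-1$: draw a fresh independent random set $S_t\sim S$, set $v^t=\sum_{i\in S_t}\frac{1}{np_i}\left(\nabla f_i(x^t)-\nabla f_i(x^{t-1})\right)+v^{t-1}$ and $x^{t+1}=x^t-\eta v^t$. Output: $x_a$ chosen uniformly at random from $\{x^t\}_{t=0}^m$. In the count of stochastic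 gradient evaluations, the full gradient $v^0$ accounts for $n$. *)

(* Defs.v *)
From HB Require Import structures.
From mathcomp Require Import all_boot all_order all_algebra.
From mathcomp Require Import all_classical all_reals all_analysis.

Set Implicit Arguments.
Unset Strict Implicit.
Unset Printing Implicit Defensive.

Import Order.TTheory GRing.Theory Num.Theory.
Import numFieldNormedType.Exports.

Local Open Scope classical_set_scope.
Local Open Scope ring_scope.

(* The library norm on 'rV[R]_d is the sup norm; it induces the same notion of
   differentiability, but smoothness constants refer to the Euclidean norm. *)
Definition enorm (R : realType) (d : nat) (x : 'rV[R]_d) : R :=
  Num.sqrt (\sum_j x 0 j ^+ 2).

Definition gradient (R : realType) (d : nat) (g : 'rV[R]_d -> R)
    (x : 'rV[R]_d) : 'rV[R]_d :=
  \row_j 'D_(delta_mx 0 j) g x.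

Definition smooth_with (R : realType) (d : nat) (g : 'rV[R]_d -> R) (l : R) :=
  forall x y, enorm (gradient g x - gradient g y) <= l * enorm (x - y).

Definition average (R : realType) (n : nat) (a : 'I_n -> R) : R :=
  n%:R^-1 * \sum_i a i.

Definition loewner_le (R : realType) (n : nat) (A B : 'M[R]_n) :=
  forall x : 'cV[R]_n, 0 <= (x^T *m (B - A) *m x) 0 0.

(* Measurability with respect to the discrete sigma-algebra on the target;
   only used for finite targets. *)
Definition random_element disp (T : measurableType disp) (E : Type)
    (X : T -> E) :=
  forall B : set E, measurable (X @^-1` B).

Definition events_of (T E : Type) (X : T -> E) : set (set T) :=
  [set X @^-1` B | B in [set: set E]].

Definition mutually_independent (R : realType) disp (T : measurableType disp)
    (P : probability T R) (I : finType) (G : I -> set (set T)) :=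
  forall (J : {set I}) (A : I -> set T), (forall i, i \in J -> G i (A i)) ->
  P (\bigcap_(i in [set i | i \in J]) A i) = (\prod_(i in J) P (A i))%E.

Definition marginal (R : realType) disp (T : measurableType disp)
    (P : probability T R) (n : nat) (S : T -> {set 'I_n}) (i : 'I_n) : R :=
  fine (P [set w | i \in S w]).

Definition probability_mx (R : realType) disp (T : measurableType disp)
    (P : probability T R) (n : nat) (S : T -> {set 'I_n}) : 'M[R]_n :=
  \matrix_(i, j) fine (P [set w | (i \in S w) && (j \in S w)]).

Definition proper_sampling (R : realType) disp (T : measurableType disp)
    (P : probability T R) (n : nat) (S : T -> {set 'I_n}) :=
  forall i, 0 < marginal P S i.

Definition batch_size (R : realType) disp (T : measurableType disp)
    (P : probability T R) (n : nat) (S : T -> {set 'I_n}) : R :=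
  fine 'E_P[fun w => #|S w|%:R].

(* P - p p^T <= Diag(p_1 v_1, ..., p_n v_n) in the Loewner order *)
Definition eso_vector (R : realType) disp (T : measurableType disp)
    (P : probability T R) (n : nat) (S : T -> {set 'I_n}) (v : 'I_n -> R) :=
  let p := \col_i marginal P S i in
  loewner_le (probability_mx P S - p *m p^T)
             (diag_mx (\row_i (marginal P S i * v i))).

Definition sarah_K (R : realType) (n : nat) (b : R) (p L v : 'I_n -> R) : R :=
  b / n%:R ^+ 2 * \sum_i (v i * L i ^+ 2 / p i).

Definition sarah_alpha (R : realType) (n : nat) (b : R) (p L v : 'I_n -> R) : R :=
  sarah_K b p L v / average L ^+ 2.

(* The pair (x^t, v^t) when the sets drawn are s 1, s 2, ...; the component x^t
   depends only on s 1, ..., s (t - 1), so s 0 is never used, and x^m is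
   obtained after m - 1 draws. *)
Fixpoint sarah_state (R : realType) (d n : nat) (f : 'I_n -> 'rV[R]_d -> R)
    (p : 'I_n -> R) (eta : R) (x0 : 'rV[R]_d) (s : nat -> {set 'I_n})
    (t : nat) : 'rV[R]_d * 'rV[R]_d :=
  if t is u.+1 then
    let: (x, g) := sarah_state f p eta x0 s u in
    let y := x - eta *: g in
    (y, \sum_(i in s u.+1)
          (n%:R * p i)^-1 *: (gradient (f i) y - gradient (f i) x) + g)
  else (x0, n%:R^-1 *: \sum_i gradient (f i) x0).

Definition sarah_iterate (R : realType) (d n : nat) (f : 'I_n -> 'rV[R]_d -> R)
    (p : 'I_n -> R) (eta : R) (x0 : 'rV[R]_d) (s : nat -> {set 'I_n})
    (t : nat) : 'rV[R]_d :=
  (sarah_state f p eta x0 s t).1.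

(* Randomness of one outer loop of length m: sets St 1, ..., St (m - 1)
   distributed as the sampling S (which lives on its own space T0) and an output
   index tau uniform on {0, ..., m}, all mutually independent.  In the
   independence clause None stands for tau and Some t for St (t + 1). *)
Record sarah_randomness (R : realType) disp0 (T0 : measurableType disp0)
    (P0 : probability T0 R) (n : nat) (S : T0 -> {set 'I_n})
    disp (T : measurableType disp) (P : probability T R)
    (m : nat) (St : nat -> T -> {set 'I_n}) (tau : T -> 'I_m.+1) : Prop := {
  draws_measurable : forall t, (0 < t < m)%N -> random_element (St t);
  draws_law : forall t (A : {set 'I_n}), (0 < t < m)%N ->
    P [set w | St t w = A] = P0 [set w | S w = A];
  index_measurable : random_element tau;
  index_uniform : forall k : 'I_m.+1,
    P [set w | tau w = k] = (m.+1%:R^-1)%:E;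
  draws_index_independent :
    mutually_independent P (fun k : option 'I_m.-1 =>
      if k is Some t then events_of (St t.+1) else events_of tau)
}.

Definition sarah_output (R : realType) (d n : nat) (f : 'I_n -> 'rV[R]_d -> R)
    (p : 'I_n -> R) (eta : R) (x0 : 'rV[R]_d) (T : Type) (m : nat)
    (St : nat -> T -> {set 'I_n}) (tau : T -> 'I_m.+1) (w : T) : 'rV[R]_d :=
  sarah_iterate f p eta x0 (fun t => St t w) (tau w).

Definition expected_sq_gradient (R : realType) (d : nat) (F : 'rV[R]_d -> R)
    disp (T : measurableType disp) (P : probability T R)
    (xa : T -> 'rV[R]_d) : \bar R :=
  'E_P[fun w => enorm (gradient F (xa w)) ^+ 2].

Definition accurate (R : realType) (d : nat) (F : 'rV[R]_d -> R) (eps : R)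
    disp (T : measurableType disp) (P : probability T R)
    (xa : T -> 'rV[R]_d) :=
  (expected_sq_gradient F P xa <= eps%:E)%E.

(* The full gradient v^0 counts for n, and inner step t for one per index drawn
   in St t: the difference of the two gradients of f_i counts once. *)
Definition sarah_evaluations (n : nat) (T : Type) (m : nat)
    (St : nat -> T -> {set 'I_n}) (w : T) : nat :=
  (n + \sum_(1 <= t < m) #|St t w|)%N.

(* Main.v *)
Require Import Defs.
From HB Require Import structures.
From mathcomp Require Import all_boot all_order all_algebra.
From mathcomp Require Import all_classical all_reals all_analysis.
From mathcomp Require Import measurable_realfun ring lra.

Set Implicit Arguments.
Unset Strict Implicit.
Unset Printing Implicit Defensive.

Import Order.TTheory GRing.Theory Num.Theory.
Import numFieldNormedType.Exports.

Local Open Scope classical_set_scope.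
Local Open Scope ring_scope.

(** Write F for the average of the f_i, G for its gradient, L for the average
    of the L_i, and let (x^t, v^t) be the state of the loop, with error
    e_t = v^t - G(x^t).  Three inequalities drive the proof.

    - Descent.  F is L-smooth, so
      F(x - eta g) <= F(x) - eta/2 |G(x)|^2 + eta/2 |g - G(x)|^2
                      - eta/2 (1 - L eta) |g|^2
      ([inexact_gradient_step]).
    - Error growth.  The correction added to v^t is an unbiased estimator of
      G(x^{t+1}) - G(x^t), and the matrix inequality on P - p p^T bounds its
      variance, one coordinate of the space at a time.  Conditionally on the
      past, E |e_{t+1}|^2 <= |e_t|^2 + kappa eta^2 |v^t|^2 with
      kappa = alpha L^2 / b ([estimator_error_growth]).
    - Step size.  The bound on eta is the positive root of
      (alpha m / b) (L eta)^2 + L eta = 1, so that m kappa eta^2 <= 1 - L eta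
      ([step_size_bound]).

    Together they say that
    sum_(k < t) |G(x^k)|^2 + 2/eta (F(x^t) - F( x* )) + (m - t) |e_t|^2
    is a supermartingale for t < m: descent leaves -(1 - L eta) |v^t|^2, which
    absorbs the (m - t - 1) kappa eta^2 |v^t|^2 created by the error
    ([potential_step], [expected_potential]).  It starts at
    2/eta (F(x^0) - F( x* )), because v^0 is the exact gradient.  Only m - 1
    sets are drawn, so the last iterate x^m has no estimator; an exact gradient
    step from it gives |G(x^m)|^2 <= 2/eta (F(x^m) - F( x* )), which ends the
    telescoping ([sq_gradient_le_gap], [potential_last]).  The uniform output
    index turns the sum over k <= m into m + 1 times the expectation at the
    output.

    All random elements take finitely many values, so every expectation is a
    finite sum against the law of (S_1, ..., S_{m-1}, tau), which independence
    makes a product ([law_outcome]).  Conditioning on the past becomes the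
    invariance of that product law under redrawing one coordinate
    ([expectation_redraw]).

    For the complexity, take the largest allowed eta.  With
    c = L (F(x^0) - F( x* )) / eps and a = alpha / b the guarantee is at most
    eps as soon as c (sqrt (1 + 4 a m) + 1) <= m + 1, hence as soon as
    m^2 >= 4 c^2 (1 + 4 a m), that is, m at least the largest root M of this
    quadratic equation.  The choice m = floor M + 1 costs n + (m - 1) b
    evaluations on average, at most n + M b, which is the claimed number
    ([loop_length_suffices], [loop_length_cost]). *)

(** * Euclidean geometry *)

Section Euclidean.
Variables (R : realType) (d : nat).
Implicit Types x y z : 'rV[R]_d.

Definition edot x y : R := \sum_j x 0 j * y 0 j.

Lemma edotC x y : edot x y = edot y x.
Proof. by apply: eq_bigr => j _; rewrite mulrC. Qed.

Lemma edotDl x y z : edot (x + y) z = edot x z + edot y z.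
Proof. by rewrite -big_split/=; apply: eq_bigr => j _; rewrite mxE mulrDl. Qed.

Lemma edotZl a x z : edot (a *: x) z = a * edot x z.
Proof. by rewrite mulr_sumr; apply: eq_bigr => j _; rewrite mxE mulrA. Qed.

Lemma edotNl x z : edot (- x) z = - edot x z.
Proof. by rewrite -scaleN1r edotZl mulN1r. Qed.

Lemma edotDr x y z : edot z (x + y) = edot z x + edot z y.
Proof. by rewrite edotC edotDl !(edotC z). Qed.

Lemma edotZr a x z : edot z (a *: x) = a * edot z x.
Proof. by rewrite edotC edotZl edotC. Qed.

Lemma edotNr x z : edot z (- x) = - edot z x.
Proof. by rewrite edotC edotNl edotC. Qed.

Definition edotE := (edotDl, edotDr, edotNl, edotNr, edotZl, edotZr).

Lemma edot_ge0 x : 0 <= edot x x.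
Proof. by apply: sumr_ge0 => j _; rewrite -expr2 sqr_ge0. Qed.

Lemma edot_eq0 x : edot x x = 0 -> x = 0.
Proof.
move=> /eqP; rewrite psumr_eq0 => [/allP x0|j _]; last by rewrite -expr2 sqr_ge0.
apply/rowP => j; have := x0 j (mem_index_enum _).
by rewrite mxE mulf_eq0 orbb => /eqP.
Qed.

Lemma enorm_ge0 x : 0 <= enorm x.
Proof. exact: sqrtr_ge0. Qed.

Lemma enorm_sq x : enorm x ^+ 2 = edot x x.
Proof. by rewrite sqr_sqrtr//; apply: sumr_ge0 => j _; rewrite sqr_ge0. Qed.

Lemma enormZ a x : enorm (a *: x) = `|a| * enorm x.
Proof.
apply/eqP; rewrite -(@eqrXn2 _ 2) ?mulr_ge0 ?enorm_ge0//.
by rewrite exprMn real_normK ?num_real// !enorm_sq !edotE mulrA.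
Qed.

(** Up to the factor [2 * enorm x * enorm y], the claim is that the square norm
    of [enorm y *: x - enorm x *: y] is nonnegative. *)
Lemma Cauchy_Schwarz x y : edot x y <= enorm x * enorm y.
Proof.
have [x0|x0] := eqVneq x 0.
  by rewrite x0 -(scale0r x) edotZl mul0r mulr_ge0 ?enorm_ge0.
have [y0|y0] := eqVneq y 0.
  by rewrite y0 -(scale0r x) edotZr mul0r mulr_ge0 ?enorm_ge0.
have enorm_gt0 z : z != 0 -> 0 < enorm z.
  move=> z0; rewrite lt_neqAle enorm_ge0 andbT eq_sym; apply: contra_neq z0 => z0.
  by apply: edot_eq0; rewrite -enorm_sq z0 expr0n.
rewrite -(ler_pM2l (mulr_gt0 (enorm_gt0 _ x0) (enorm_gt0 _ y0))).
have := edot_ge0 (enorm y *: x - enorm x *: y).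
by rewrite !edotE (edotC y x) -!enorm_sq; lra.
Qed.

Lemma enormD x y : enorm (x + y) <= enorm x + enorm y.
Proof.
rewrite -ler_sqr ?nnegrE ?addr_ge0 ?enorm_ge0// sqrrD !enorm_sq !edotE (edotC y x).
have := Cauchy_Schwarz x y; lra.
Qed.

Lemma enorm_sum (I : Type) (r : seq I) (a : I -> 'rV[R]_d) :
  enorm (\sum_(i <- r) a i) <= \sum_(i <- r) enorm (a i).
Proof.
elim/big_rec2 : _ => [|i y x _ xy]; last exact: (le_trans (enormD _ _) (lerD _ _)).
by rewrite -(scale0r 0) enormZ normr0 mul0r.
Qed.

End Euclidean.

(** * Smooth functions and their averages *)

Section Smooth.
Variables (R : realType) (d : nat).
Implicit Types (x y h : 'rV[R]_d) (g : 'rV[R]_d -> R).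

Lemma derive_gradient g x h :
  differentiable g x -> 'D_h g x = edot (gradient g x) h.
Proof.
move=> dg; rewrite deriveE// [in LHS](row_sum_delta h) linear_sum/=.
by apply: eq_bigr => j _; rewrite linearZ/= mxE deriveE// mulrC.
Qed.

(** The restriction of [g] to a line has the same difference quotients as the
    directional derivative of [g]. *)
Lemma is_derive_line g x h (t : R) : differentiable g (x + t *: h) ->
  is_derive t 1 (fun s : R => g (x + s *: h)) (edot (gradient g (x + t *: h)) h).
Proof.
move=> dg.
have E : (fun s : R => s^-1 *: (((fun s : R => g (x + s *: h)) \o shift t) (s *: 1)
            - g (x + t *: h)))
  = (fun s : R => s^-1 *: ((g \o shift (x + t *: h)) (s *: h) - g (x + t *: h))).
  apply/funext => s /=; congr (_ *: (g _ - _)).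
  by rewrite [s *: 1]mulr1 scalerDl addrCA.
split; first by rewrite /derivable E; exact: diff_derivable.
by rewrite /derive E -derive_gradient.
Qed.

(** The function [t |-> g (x + t h) - t <grad g x, h> - l t^2 |h|^2 / 2] is
    nonincreasing on [0, 1], because its derivative
    [<grad g (x + t h) - grad g x, h> - l t |h|^2] is nonpositive by
    Cauchy-Schwarz and smoothness. *)
Lemma descent_lemma g (l : R) x h :
  (forall y, differentiable g y) -> smooth_with g l ->
  g (x + h) <= g x + edot (gradient g x) h + l / 2 * edot h h.
Proof.
move=> dg sg.
pose a := edot (gradient g x) h; pose b := l / 2 * edot h h.
pose phi := fun t : R => g (x + t *: h) - (t * a + t ^+ 2 * b).
have dphi (t : R) : is_derive t 1 phi
    (edot (gradient g (x + t *: h)) h - (a + 2 * t * b)).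
  apply: is_deriveB; first exact: is_derive_line.
  apply: is_derive_eq; rewrite /GRing.scale/=; ring.
suff : phi 1 <= phi 0.
  rewrite /phi /a /b !scale1r scale0r addr0; lra.
have dphi1 (t : R) : derivable phi t 1 by [].
apply: (@ler0_derive1_le_cc _ phi 0 1) => //; rewrite ?in_itv/= ?lexx ?ler01//.
- move=> t; rewrite in_itv/= => /andP[t0 t1].
  rewrite derive1E (@derive_val _ _ _ _ _ _ _ (dphi t)).
  have -> : edot (gradient g (x + t *: h)) h - (a + 2 * t * b)
          = edot (gradient g (x + t *: h) - gradient g x) h - l * t * enorm h ^+ 2.
    by rewrite !edotE enorm_sq /a /b; field.
  rewrite subr_le0 (le_trans (Cauchy_Schwarz _ _))//.
  rewrite expr2 mulrA ler_wpM2r ?enorm_ge0//.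
  by rewrite (le_trans (sg _ _))// addrC addKr enormZ ger0_norm ?mulrA// ltW.
- apply: continuous_subspaceT => t.
  by apply: differentiable_continuous; exact/derivable1_diffP.
Qed.

Lemma averageE n (f : 'I_n -> 'rV[R]_d -> R) :
  (fun x => average (fun i => f i x)) = n%:R^-1 \*: (\sum_i f i).
Proof. by apply/funext => x; rewrite /average fct_sumE. Qed.

Lemma differentiable_average n (f : 'I_n -> 'rV[R]_d -> R) x :
  (forall i, differentiable (f i) x) ->
  differentiable (fun x => average (fun i => f i x)) x.
Proof.
by move=> df; rewrite averageE; apply: differentiableZ; exact: differentiable_sum.
Qed.

Lemma gradient_average n (f : 'I_n -> 'rV[R]_d -> R) x :
  (forall i, differentiable (f i) x) ->
  gradient (fun x => average (fun i => f i x)) x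
  = n%:R^-1 *: \sum_i gradient (f i) x.
Proof.
move=> df; rewrite averageE; apply/rowP => j; rewrite !mxE summxE.
have dd i : derivable (f i) x (delta_mx 0 j) by exact: diff_derivable.
rewrite deriveZ; last exact: derivable_sum.
by rewrite derive_sum//; congr (_ * _); apply: eq_bigr => i _; rewrite mxE.
Qed.

Lemma smooth_average n (f : 'I_n -> 'rV[R]_d -> R) (L : 'I_n -> R) :
  (forall i x, differentiable (f i) x) -> (forall i, smooth_with (f i) (L i)) ->
  smooth_with (fun x => average (fun i => f i x)) (average L).
Proof.
move=> df sf x y; rewrite !gradient_average// -scalerBr -sumrB enormZ.
rewrite ger0_norm ?invr_ge0// -mulrA ler_wpM2l ?invr_ge0//.
rewrite (le_trans (enorm_sum _ _))// mulr_suml.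
by apply: ler_sum => i _; exact: sf.
Qed.

End Smooth.

(** * Laws of random elements of finite types *)

Section FiniteLaw.
Variables (R : realType) (disp : measure_display) (T : measurableType disp).
Variables (P : probability T R).

Definition law (E : Type) (X : T -> E) (e : E) : R :=
  fine (P [set w | X w = e]).

Section OneElement.
Variables (E : finType) (X : T -> E).
Hypothesis mX : random_element X.

Lemma fiber_measurable (e : E) : measurable [set w | X w = e].
Proof. exact: (mX [set e]). Qed.

Lemma lawE e : P [set w | X w = e] = (law X e)%:E.
Proof. by rewrite fineK// fin_num_measure//; exact: fiber_measurable. Qed.

Lemma law_ge0 e : 0 <= law X e.
Proof. by rewrite fine_ge0. Qed.

Lemma expectation_finite (phi : E -> R) : (forall e, 0 <= phi e) ->
  'E_P[fun w => phi (X w)]%E = (\sum_e law X e * phi e)%:E.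
Proof.
move=> phi0; rewrite unlock.
have -> : (fun w => (phi (X w))%:E)
  = (fun w => \sum_(e <- index_enum E)
      ((phi e)%:E * (\1_[set w | X w = e] w)%:E))%E.
  apply/funext => w; rewrite (bigD1_seq (X w)) ?mem_index_enum ?index_enum_uniq//=.
  rewrite big1 => [|e /negPf eX]; rewrite indicE.
    by rewrite mem_set//= mule1 adde0.
  by rewrite memNset ?mule0//= => /esym/eqP; rewrite eX.
have m1 e : measurable_fun setT (EFin \o \1_[set w | X w = e] : T -> \bar R).
  by apply/measurable_EFinP; apply: measurable_indic; exact: fiber_measurable.
rewrite ge0_integral_sum//; last 2 first.
- by move=> e; exact: (measurable_funeM (phi e)%:E (m1 e)).
- by move=> e w _; rewrite mule_ge0// lee_fin.
rewrite -sumEFin; apply: eq_bigr => e _.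
rewrite ge0_integralZl_EFin//; last exact: m1.
rewrite integral_indic//; last exact: fiber_measurable.
by rewrite setIT mulrC EFinM -lawE.
Qed.

Lemma probability_finite (Q : pred E) :
  P [set w | Q (X w)] = (\sum_e law X e * (Q e)%:R)%:E.
Proof.
rewrite -expectation_finite//.
rewrite -expectation_indic; last exact: (mX [set e | Q e]).
congr expectation; apply/funext => w; rewrite indicE/=.
by have [h|/negP h] := boolP (Q (X w)); [rewrite mem_set | rewrite memNset].
Qed.

Lemma law_sum1 : \sum_e law X e = 1.
Proof.
have := probability_finite xpredT.
have -> : [set w | xpredT (X w)] = setT by apply/seteqP; split.
rewrite probability_setT => -[->]; by apply: eq_bigr => e _; rewrite mulr1.
Qed.

End OneElement.
End FiniteLaw.

(** * First and second moments of a sampling *)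

Section Sampling.
Variables (R : realType) (disp0 : measure_display) (T0 : measurableType disp0).
Variables (P0 : probability T0 R) (n : nat) (S : T0 -> {set 'I_n}).
Hypothesis S_rand : random_element S.

Local Notation q := (law P0 S).
Local Notation p := (marginal P0 S).

Lemma marginalE i : p i = \sum_A q A * (i \in A)%:R.
Proof. by rewrite /marginal (probability_finite P0 S_rand (fun A => i \in A)). Qed.

Lemma probability_mxE i j :
  probability_mx P0 S i j = \sum_A q A * ((i \in A) && (j \in A))%:R.
Proof.
by rewrite mxE (probability_finite P0 S_rand (fun A => (i \in A) && (j \in A))).
Qed.

Lemma sum_mem (A : {set 'I_n}) (u : 'I_n -> R) :
  \sum_(i in A) u i = \sum_i (i \in A)%:R * u i.
Proof.
by rewrite big_mkcond/=; apply: eq_bigr => i _; case: ifP; rewrite ?mul1r ?mul0r.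
Qed.

Lemma sampling_mean (u : 'I_n -> R) :
  \sum_A q A * (\sum_(i in A) u i) = \sum_i p i * u i.
Proof.
under eq_bigr do rewrite sum_mem mulr_sumr.
rewrite exchange_big/=; apply: eq_bigr => i _.
by rewrite marginalE mulr_suml; apply: eq_bigr => A _; rewrite mulrA.
Qed.

Lemma batch_sizeE : batch_size P0 S = \sum_A q A * #|A|%:R.
Proof.
by rewrite /batch_size (expectation_finite P0 S_rand (phi := fun A => #|A|%:R)).
Qed.

Lemma batch_size_sum : batch_size P0 S = \sum_i p i.
Proof.
rewrite batch_sizeE -[RHS](eq_bigr _ (fun i _ => mulr1 (p i))) -sampling_mean.
by apply: eq_bigr => A _; rewrite sumr_const.
Qed.

Lemma sampling_second_moment (u : 'I_n -> R) :
  \sum_A q A * (\sum_(i in A) u i) ^+ 2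
  = \sum_i \sum_j probability_mx P0 S i j * (u i * u j).
Proof.
under eq_bigr do rewrite sum_mem expr2 mulr_suml mulr_sumr.
rewrite exchange_big/=; apply: eq_bigr => i _.
under eq_bigr do rewrite mulr_sumr mulr_sumr.
rewrite exchange_big/=; apply: eq_bigr => j _.
rewrite probability_mxE mulr_suml; apply: eq_bigr => A _.
by case: (i \in A); case: (j \in A); rewrite /= ?(mul0r, mulr0, mul1r, mulr1).
Qed.

Variable v : 'I_n -> R.
Hypothesis v_eso : eso_vector P0 S v.

(** The left-hand side is the quadratic form of [P - p p^T] at [u], which is the
    variance of the sum of [u] over a random set. *)
Lemma eso_quadratic (u : 'I_n -> R) :
  \sum_A q A * (\sum_(i in A) u i) ^+ 2 - (\sum_i p i * u i) ^+ 2
  <= \sum_i p i * v i * u i ^+ 2.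
Proof.
rewrite -subr_ge0; have := v_eso (\col_i u i).
rewrite mulmxBr mulmxBl mulmxBr mulmxBl !mxE.
set a := \sum_j _; set b := \sum_j _; set c := \sum_j _.
have -> : a = \sum_i p i * v i * u i ^+ 2.
  apply: eq_bigr => i _; rewrite mul_mx_diag !mxE; ring.
have -> : b = \sum_A q A * (\sum_(i in A) u i) ^+ 2.
  rewrite sampling_second_moment exchange_big/=; apply: eq_bigr => i _.
  rewrite !mxE mulr_suml; apply: eq_bigr => j _; rewrite !mxE; ring.
have -> : c = (\sum_i p i * u i) ^+ 2.
  rewrite expr2 mulr_suml; apply: eq_bigr => i _.
  rewrite mulrC !mxE !mulr_sumr; apply: eq_bigr => j _.
  rewrite !mxE big_ord1 !mxE; ring.
by lra.
Qed.

(** The matrix inequality tested on the basis vectors reads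
    [p_i (1 - p_i) <= p_i v_i]. *)
Lemma eso_ge0 : proper_sampling P0 S -> forall i, 0 <= v i.
Proof.
move=> S_proper i; have := eso_quadratic (fun j => (j == i)%:R).
have delta (w : 'I_n -> R) : \sum_j w j * (j == i)%:R = w i.
  rewrite (bigD1 i)//= eqxx mulr1 big1 ?addr0// => j /negPf ->; exact: mulr0.
have delta_in (A : {set 'I_n}) : \sum_(j in A) (j == i)%:R = (i \in A)%:R :> R.
  by rewrite sum_mem delta.
have sq (b : bool) : b%:R ^+ 2 = b%:R :> R by case: b; rewrite expr2 ?mul0r ?mul1r.
under eq_bigr do rewrite delta_in sq.
under [X in _ <= X]eq_bigr do rewrite sq.
rewrite !delta -marginalE => h.
have p1 : p i <= 1.
  rewrite marginalE -[leRHS](law_sum1 P0 S_rand); apply: ler_sum => A _.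
  by rewrite ler_piMr ?law_ge0//; case: (i \in A); rewrite /= ?ler01.
by have := S_proper i; nra.
Qed.

(** The centred sum over a random set has mean zero, so that its cross term with
    the constant [c] vanishes; [c] will be a coordinate of the current error. *)
Lemma sampling_variance (c : R) (u : 'I_n -> R) :
  \sum_A q A * (c + (\sum_(i in A) u i - \sum_i p i * u i)) ^+ 2
  <= c ^+ 2 + \sum_i p i * v i * u i ^+ 2.
Proof.
apply: le_trans (lerD (lexx (c ^+ 2)) (eso_quadratic u)).
set m := \sum_i p i * u i.
have -> : \sum_A q A * (c + (\sum_(i in A) u i - m)) ^+ 2
  = \sum_A q A * (\sum_(i in A) u i) ^+ 2
    + 2 * (c - m) * (\sum_A q A * (\sum_(i in A) u i)) + (c - m) ^+ 2 * \sum_A q A.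
  rewrite !mulr_sumr -!big_split/=; apply: eq_bigr => A _; ring.
by rewrite sampling_mean -/m law_sum1//; lra.
Qed.

End Sampling.

(** * One step of the loop *)

Definition corrected (R : realType) (d n : nat) (f : 'I_n -> 'rV[R]_d -> R)
    (p : 'I_n -> R) (x y g : 'rV[R]_d) (A : {set 'I_n}) : 'rV[R]_d :=
  \sum_(i in A) (n%:R * p i)^-1 *: (gradient (f i) y - gradient (f i) x) + g.

Section OneStep.
Variables (R : realType) (d n : nat).
Variables (f : 'I_n -> 'rV[R]_d -> R) (L : 'I_n -> R) (fmin : R).
Variables (disp0 : measure_display) (T0 : measurableType disp0).
Variables (P0 : probability T0 R) (S : T0 -> {set 'I_n}) (v : 'I_n -> R).
Hypothesis f_diff : forall i x, differentiable (f i) x.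
Hypothesis f_smooth : forall i, smooth_with (f i) (L i).
Hypothesis S_rand : random_element S.
Hypothesis S_proper : proper_sampling P0 S.
Hypothesis v_eso : eso_vector P0 S v.

Local Notation F := (fun x => average (fun i => f i x)).
Local Notation G := (gradient F).
Local Notation q := (law P0 S).
Local Notation p := (marginal P0 S).

Hypothesis fmin_le : forall x, fmin <= F x.

(** This is the quotient of [sarah_K] by the batch size: the constant [kappa] in
    the bound [kappa |y - x|^2] on the variance of one correction. *)
Definition eso_variance : R := n%:R^-2 * \sum_i v i * L i ^+ 2 / p i.

(** In coordinate [j] the new error is the old one plus the centred sum of
    [u j i = (n p_i)^-1 a_i j] over the random set, where [a_i] is the change of
    the gradient of [f i]; the factor [p_i v_i / (n p_i)^2] that the variance
    bound puts on [a_i] then meets the smoothness of [f i]. *)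
Lemma estimator_error_growth (x y g : 'rV[R]_d) :
  \sum_A q A * enorm (corrected f p x y g A - G y) ^+ 2
  <= enorm (g - G x) ^+ 2 + eso_variance * enorm (y - x) ^+ 2.
Proof.
pose a i := gradient (f i) y - gradient (f i) x.
pose u j i := (n%:R * p i)^-1 * a i 0 j.
have coord A j : (corrected f p x y g A - G y) 0 j
    = (g - G x) 0 j + (\sum_(i in A) u j i - \sum_i p i * u j i).
  have -> : \sum_i p i * u j i = (G y - G x) 0 j.
    rewrite !gradient_average// -scalerBr -sumrB mxE summxE mulr_sumr.
    apply: eq_bigr => i _; have pi0 : p i != 0 by rewrite gt_eqF// S_proper.
    by rewrite /u invfM mulrA mulrCA mulfV// mulr1 !mxE.
  rewrite /corrected !mxE summxE; under eq_bigr do rewrite mxE.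
  rewrite /u /a; ring.
apply: (@le_trans _ _ (\sum_j ((g - G x) 0 j ^+ 2 + \sum_i p i * v i * u j i ^+ 2))).
  under eq_bigr do rewrite enorm_sq /edot mulr_sumr.
  rewrite exchange_big/=; apply: ler_sum => j _.
  under eq_bigr do rewrite -expr2 coord.
  exact: sampling_variance.
rewrite big_split/= enorm_sq; apply: lerD.
  by apply: ler_sum => j _; rewrite expr2.
rewrite exchange_big/= /eso_variance mulr_sumr mulr_suml.
apply: ler_sum => i _.
have -> : \sum_j p i * v i * u j i ^+ 2 = n%:R^-2 * (v i / p i) * enorm (a i) ^+ 2.
  rewrite enorm_sq mulr_sumr; apply: eq_bigr => j _.
  have pi0 : p i != 0 by rewrite gt_eqF// S_proper.
  have n0 : n%:R != 0 :> R by rewrite pnatr_eq0 -lt0n; exact: leq_trans (ltn_ord i).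
  by rewrite /u; field; rewrite pi0 n0.
have -> : n%:R^-2 * (v i * L i ^+ 2 / p i) * enorm (y - x) ^+ 2
          = n%:R^-2 * (v i / p i) * (L i * enorm (y - x)) ^+ 2.
  rewrite exprMn; ring.
apply: ler_wpM2l.
  rewrite mulr_ge0 ?invr_ge0 ?exprn_ge0// divr_ge0//.
    exact: (eso_ge0 S_rand v_eso S_proper).
  exact/ltW/S_proper.
have sm := f_smooth i y x.
by rewrite ler_sqr// ?nnegrE ?enorm_ge0// (le_trans (enorm_ge0 _) sm).
Qed.

Variable eta : R.
Hypothesis eta_gt0 : 0 < eta.

(** The descent lemma, with the inner product of [G x] and [g] expressed through
    the square norms of [G x], [g] and [g - G x]. *)
Lemma inexact_gradient_step (x g : 'rV[R]_d) :
  F (x - eta *: g) <= F x - eta / 2 * enorm (G x) ^+ 2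
    + eta / 2 * enorm (g - G x) ^+ 2
    - eta / 2 * (1 - average L * eta) * enorm g ^+ 2.
Proof.
have dF y : differentiable F y by exact: differentiable_average.
have := descent_lemma x (- (eta *: g)) dF (smooth_average f_diff f_smooth).
by rewrite !enorm_sq !edotE (edotC g (G x)); lra.
Qed.

(** The weight [c] stands for the number of remaining steps: an error made now
    persists in all of them. *)
Definition potential (c : R) (s : 'rV[R]_d * 'rV[R]_d) : R :=
  2 / eta * (F s.1 - fmin) + c * enorm (s.2 - G s.1) ^+ 2.

(** The term [- (1 - L eta) |g|^2] of the descent inequality pays for the error
    growth [c * kappa * eta^2 * |g|^2] of the following iterates. *)
Lemma potential_step (c : R) (x g : 'rV[R]_d) :
  0 <= c -> c * eso_variance * eta ^+ 2 <= 1 - average L * eta ->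
  enorm (G x) ^+ 2
  + \sum_A q A * potential c (x - eta *: g, corrected f p x (x - eta *: g) g A)
  <= potential (c + 1) (x, g).
Proof.
move=> c0 c_small; rewrite /potential/=; set y := x - eta *: g.
have -> (K : R) (e : {set 'I_n} -> R) :
    \sum_A q A * (K + c * e A) = K + c * \sum_A q A * e A.
  under eq_bigr do rewrite mulrDr mulrCA.
  by rewrite big_split/= -mulr_suml law_sum1// mul1r mulr_sumr.
have e := ler_wpM2l c0 (estimator_error_growth x y g).
have s := inexact_gradient_step x g; rewrite -/y in s.
have -> : 2 / eta * (F x - fmin) = 2 / eta * (F y - fmin) + 2 / eta * (F x - F y) by ring.
have /(ler_wpM2l (ltW (divr_gt0 (ltr0n R 2) eta_gt0))) s' :
   eta / 2 * enorm (G x) ^+ 2 - eta / 2 * enorm (g - G x) ^+ 2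
    + eta / 2 * (1 - average L * eta) * enorm g ^+ 2 <= F x - F y by lra.
have yx : enorm (y - x) ^+ 2 = eta ^+ 2 * enorm g ^+ 2.
  by rewrite !enorm_sq /y addrAC subrr add0r !edotE; ring.
rewrite yx in e.
have k := ler_wpM2r (sqr_ge0 (enorm g)) c_small.
have E : 2 / eta * (eta / 2 * enorm (G x) ^+ 2 - eta / 2 * enorm (g - G x) ^+ 2
    + eta / 2 * (1 - average L * eta) * enorm g ^+ 2)
  = enorm (G x) ^+ 2 - enorm (g - G x) ^+ 2 + (1 - average L * eta) * enorm g ^+ 2.
  by field; rewrite gt_eqF.
rewrite E in s'; lra.
Qed.

Hypothesis eta_small : average L * eta <= 1.

(** The exact gradient step from [x] cannot go below [fmin]. *)
Lemma sq_gradient_le_gap (x : 'rV[R]_d) :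
  enorm (G x) ^+ 2 <= 2 / eta * (F x - fmin).
Proof.
have s := le_trans (fmin_le _) (inexact_gradient_step x (G x)).
rewrite subrr -(scale0r 0) enormZ normr0 mul0r expr0n/= mulr0 addr0 in s.
have k := mulr_ge0 (mulr_ge0 (ltW (divr_gt0 eta_gt0 (ltr0n R 2)))
   (etrans (subr_ge0 _ _) eta_small)) (sqr_ge0 (enorm (G x))).
rewrite -(ler_pM2l (divr_gt0 eta_gt0 (ltr0n R 2))).
have -> : eta / 2 * (2 / eta * (F x - fmin)) = F x - fmin by field; rewrite gt_eqF.
by lra.
Qed.

(** The last two iterates together: the final one is reached without drawing a
    new set. *)
Lemma potential_last (x g : 'rV[R]_d) :
  enorm (G x) ^+ 2 + enorm (G (x - eta *: g)) ^+ 2 <= potential 1 (x, g).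
Proof.
have l := sq_gradient_le_gap (x - eta *: g).
apply: le_trans (lerD (lexx _) l) _.
have := @potential_step 0 x g (lexx _); rewrite !mul0r subr_ge0 add0r.
move=> /(_ eta_small); apply: le_trans; rewrite lerD2l.
under eq_bigr do rewrite /potential mul0r addr0/=.
by rewrite -mulr_suml law_sum1// mul1r.
Qed.

End OneStep.

(** * Expectations over independent draws *)

Section IndependentDraws.
Variables (R : realType) (I X : finType) (q : X -> R).
Hypothesis q1 : \sum_a q a = 1.
Implicit Types (h : {ffun I -> X}).

Definition weight h : R := \prod_i q (h i).

Lemma weight_sum1 : \sum_h weight h = 1.
Proof. by rewrite -(bigA_distr_bigA (fun=> q))/= big1. Qed.

Definition redraw h i a : {ffun I -> X} := [ffun j => if j == i then a else h j].

(** Exchanging the coordinate [h i] with a fresh draw [a] is an involution of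
    the pairs [(h, a)] that preserves [weight h * q a]. *)
Lemma expectation_redraw i (phi : {ffun I -> X} -> R) :
  \sum_h weight h * phi h = \sum_h weight h * \sum_a q a * phi (redraw h i a).
Proof.
under [RHS]eq_bigr do rewrite mulr_sumr.
rewrite pair_bigA/=.
pose swap (z : {ffun I -> X} * X) := (redraw z.1 i z.2, z.1 i).
have swapK : involutive swap.
  case=> h a; congr pair; last by rewrite ffunE eqxx.
  by apply/ffunP => j; rewrite !ffunE; case: eqVneq => [->|].
rewrite (reindex_inj (inv_inj swapK))/=.
have E h a : weight (redraw h i a) * (q (h i) * phi (redraw (redraw h i a) i (h i)))
    = weight h * phi h * q a.
  have -> : redraw (redraw h i a) i (h i) = h.
    by apply/ffunP => j; rewrite !ffunE; case: eqVneq => [->|].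
  rewrite /weight (bigD1 i)//= [in RHS](bigD1 i)//= ffunE eqxx.
  have -> : \prod_(j | j != i) q (redraw h i a j) = \prod_(j | j != i) q (h j).
    by apply: eq_bigr => j /negPf ji; rewrite ffunE ji.
  ring.
under [RHS]eq_bigr do rewrite E.
rewrite -(pair_bigA _ (fun h a => weight h * phi h * q a))/=.
by apply: eq_bigr => h _; rewrite -mulr_sumr q1 mulr1.
Qed.

Lemma expectation_coordinate i (phi : X -> R) :
  \sum_h weight h * phi (h i) = \sum_a q a * phi a.
Proof.
rewrite (expectation_redraw i).
under eq_bigr do under eq_bigr do rewrite ffunE eqxx.
by rewrite -mulr_suml weight_sum1 mul1r.
Qed.

End IndependentDraws.

(** * Expected potential along the trajectory *)

Section Trajectory.
Variables (R : realType) (d n : nat).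
Variables (f : 'I_n -> 'rV[R]_d -> R) (p : 'I_n -> R) (eta : R) (x0 : 'rV[R]_d).

Local Notation state := (sarah_state f p eta x0).

Lemma sarah_stateS s t : state s t.+1
  = ((state s t).1 - eta *: (state s t).2,
     corrected f p (state s t).1 ((state s t).1 - eta *: (state s t).2)
       (state s t).2 (s t.+1)).
Proof. by rewrite /=; case: (sarah_state _ _ _ _ _ _). Qed.

Lemma sarah_state_ext s s' t : (forall u, (0 < u <= t)%N -> s u = s' u) ->
  state s t = state s' t.
Proof.
elim: t => [//|t IH] ss'; rewrite !sarah_stateS ss' ?ltnSn ?leqnn// IH// => u.
by move=> /andP[u0 ut]; apply: ss'; rewrite u0 leqW.
Qed.

Lemma sarah_iterate_ext s s' t : (forall u, (0 < u < t)%N -> s u = s' u) ->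
  sarah_iterate f p eta x0 s t = sarah_iterate f p eta x0 s' t.
Proof.
rewrite /sarah_iterate; case: t => [//|t] ss'.
by rewrite !sarah_stateS/= (sarah_state_ext ss').
Qed.

(** Entry [i] of [h] is the set of the inner step [i + 1]; the values at 0 and
    beyond [r] do not influence the first [r + 1] iterates after [x0]. *)
Definition draws r (h : {ffun 'I_r -> {set 'I_n}}) (t : nat) : {set 'I_n} :=
  if insub t.-1 is Some i then h i else finset.set0.

Lemma drawsS r (h : {ffun 'I_r -> {set 'I_n}}) (i : 'I_r) : draws h i.+1 = h i.
Proof. by rewrite /draws/= valK. Qed.

Lemma draws_redraw r (h : {ffun 'I_r -> {set 'I_n}}) (i : 'I_r) A t :
  (0 < t <= i)%N -> draws (redraw h i A) t = draws h t.
Proof.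
case: t => [//|t]/= ti; rewrite /draws/=; case: insubP => [j _ jt|//].
by rewrite ffunE -val_eqE/= jt ltn_eqF.
Qed.

End Trajectory.

Section ExpectedPotential.
Variables (R : realType) (d n : nat).
Variables (f : 'I_n -> 'rV[R]_d -> R) (L : 'I_n -> R) (fmin : R).
Variables (disp0 : measure_display) (T0 : measurableType disp0).
Variables (P0 : probability T0 R) (S : T0 -> {set 'I_n}) (v : 'I_n -> R).
Hypothesis f_diff : forall i x, differentiable (f i) x.
Hypothesis f_smooth : forall i, smooth_with (f i) (L i).
Hypothesis S_rand : random_element S.
Hypothesis S_proper : proper_sampling P0 S.
Hypothesis v_eso : eso_vector P0 S v.

Local Notation F := (fun x => average (fun i => f i x)).
Local Notation G := (gradient F).
Local Notation q := (law P0 S).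
Local Notation p := (marginal P0 S).

Hypothesis fmin_le : forall x, fmin <= F x.

Variables (eta : R) (r : nat) (x0 : 'rV[R]_d).
Hypothesis eta_gt0 : 0 < eta.
Hypothesis eta_small :
  r.+1%:R * eso_variance L P0 S v * eta ^+ 2 <= 1 - average L * eta.

Local Notation iterate h t := (sarah_iterate f p eta x0 (draws h) t).
Local Notation state h t := (sarah_state f p eta x0 (draws h) t).
Local Notation Phi := (potential f fmin eta).

Lemma eso_variance_ge0 : 0 <= eso_variance L P0 S v.
Proof.
rewrite mulr_ge0 ?invr_ge0 ?exprn_ge0//; apply: sumr_ge0 => i _.
apply: divr_ge0; last exact/ltW/S_proper.
apply: mulr_ge0; last exact: sqr_ge0.
exact: (eso_ge0 S_rand v_eso S_proper).
Qed.

Lemma eta_smaller (k : nat) : (k <= r.+1)%N ->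
  k%:R * eso_variance L P0 S v * eta ^+ 2 <= 1 - average L * eta.
Proof.
move=> kr; apply: le_trans eta_small.
by rewrite !ler_wpM2r ?sqr_ge0 ?eso_variance_ge0 ?ler_nat.
Qed.

(** The sum of the square gradients along the first [t] iterates plus the
    potential of the current state is a supermartingale: redrawing the set used
    in step [t + 1] leaves the state after [t] steps unchanged, so
    [potential_step] applies conditionally on it. *)
Lemma expected_potential (t : nat) : (t <= r)%N ->
  \sum_(h : {ffun 'I_r -> {set 'I_n}}) weight q h *
     (\sum_(k < t) enorm (G (iterate h k)) ^+ 2 + Phi (r.+1 - t)%:R (state h t))
  <= 2 / eta * (F x0 - fmin).
Proof.
elim: t => [_|t IH tr].
  under eq_bigr do rewrite big_ord0 add0r /potential/=.
  rewrite -mulr_suml weight_sum1 ?law_sum1// mul1r.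
  rewrite gradient_average// subrr -(scale0r 0) enormZ normr0 mul0r expr0n/= mulr0.
  by rewrite addr0.
apply: le_trans (IH (ltnW tr)).
pose i := Ordinal tr.
rewrite (expectation_redraw (law_sum1 P0 S_rand) i).
apply: ler_sum => h _; apply: ler_wpM2l.
  by apply: prodr_ge0 => j _; exact: law_ge0.
have same A : state (redraw h i A) t = state h t.
  by apply: sarah_state_ext => u ut; rewrite draws_redraw.
have sameG A (k : 'I_t.+1) : G (iterate (redraw h i A) k) = G (iterate h k).
  congr G; apply: sarah_iterate_ext => u /andP[u0 uk].
  by rewrite draws_redraw// u0/= -ltnS (leq_trans uk)// ltnW.
under eq_bigr do rewrite sarah_stateS same (drawsS _ i) ffunE eqxx
  (eq_bigr _ (fun k _ => congr1 (fun z => enorm z ^+ 2) (sameG _ k))).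
under eq_bigr do rewrite mulrDr.
rewrite big_split/= -mulr_suml law_sum1// mul1r big_ord_recr/= -addrA lerD2l.
rewrite subSS subSn ?(ltnW tr)// -[in leRHS]natr1.
have := @potential_step _ _ _ f L fmin _ _ P0 S v f_diff f_smooth S_rand S_proper
  v_eso _ eta_gt0 (r - t)%:R (state h t).1 (state h t).2 (ler0n _ _).
by rewrite -surjective_pairing; apply; apply: eta_smaller; rewrite leqW ?leq_subr.
Qed.

Lemma expected_sum_sq_gradients :
  \sum_(h : {ffun 'I_r -> {set 'I_n}}) weight q h *
     (\sum_(k < r.+2) enorm (G (iterate h k)) ^+ 2)
  <= 2 / eta * (F x0 - fmin).
Proof.
apply: le_trans (expected_potential (leqnn r)).
apply: ler_sum => h _; apply: ler_wpM2l.
  by apply: prodr_ge0 => j _; exact: law_ge0.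
rewrite big_ord_recr big_ord_recr/= -addrA lerD2l subSnn.
rewrite /sarah_iterate sarah_stateS/= [state h r in leRHS]surjective_pairing.
apply: (potential_last f_diff f_smooth S_rand S_proper v_eso) => //.
by have := eta_smaller (leq0n _); rewrite !mul0r subr_ge0.
Qed.

End ExpectedPotential.

(** * The law of one outer loop *)

Section OuterLoopLaw.
Variables (R : realType) (n r : nat).
Variables (disp0 : measure_display) (T0 : measurableType disp0).
Variables (P0 : probability T0 R) (S : T0 -> {set 'I_n}).
Variables (disp : measure_display) (T : measurableType disp).
Variables (P : probability T R) (St : nat -> T -> {set 'I_n}) (tau : T -> 'I_r.+2).
Hypothesis S_rand : random_element S.
Hypothesis rnd : sarah_randomness P0 S P St tau.

Local Notation q := (law P0 S).

Definition history (w : T) : {ffun 'I_r -> {set 'I_n}} :=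
  [ffun i : 'I_r => St i.+1 w].

Definition outcome (w : T) := (history w, tau w).

(** The index set [option 'I_r] is that of the independence hypothesis, [None]
    being the output index. *)
Definition outcome_event (z : {ffun 'I_r -> {set 'I_n}} * 'I_r.+2)
    (o : option 'I_r) : set T :=
  if o is Some i then [set w | St i.+1 w = z.1 i] else [set w | tau w = z.2].

Lemma outcome_fiber z : [set w | outcome w = z]
  = \bigcap_(o in [set o | o \in [set: option 'I_r]%SET]) outcome_event z o.
Proof.
case: z => h k; apply/seteqP; split => w /=.
  by case=> <- <- [i|] _ //=; rewrite ffunE.
move=> ev; congr pair; last by have := ev None (finset.in_setT _).
by apply/ffunP => i; rewrite ffunE; have := ev (Some i) (finset.in_setT _).
Qed.

Lemma random_element_outcome : random_element outcome.
Proof.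
move=> B; have -> : outcome @^-1` B = \bigcup_(z in B) [set w | outcome w = z].
  by apply/seteqP; split => w; [exists (outcome w) | case=> z /= Bz ->].
apply: fin_bigcup_measurable => [|z _]; first exact: finite_finset.
rewrite outcome_fiber.
apply: fin_bigcap_measurable => [|[i|] _]; first exact: finite_finset.
- exact: (draws_measurable rnd (t := i.+1) (ltn_ord i) [set z.1 i]).
- exact: (index_measurable rnd [set z.2]).
Qed.

Lemma law_outcome h k : law P outcome (h, k) = weight q h * r.+2%:R^-1.
Proof.
rewrite /law outcome_fiber (draws_index_independent rnd); last first.
  move=> [i|] _ /=; first by exists [set h i].
  by exists [set k].
rewrite (bigD1 None) ?finset.in_setT//= (index_uniform rnd).
rewrite (reindex_omap (@Some _) (fun o : option 'I_r => o)); last first.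
  by case=> [i|] //=; rewrite andbF.
rewrite (eq_bigl xpredT); last by move=> i /=; rewrite finset.in_setT eqxx.
rewrite (eq_bigr (fun i => (q (h i))%:E)) => [|i _]; last first.
  by rewrite (draws_law rnd (t := i.+1) _ (ltn_ord i)) -lawE.
by rewrite prodEFin -EFinM/= mulrC.
Qed.

Lemma expectation_outcome (phi : {ffun 'I_r -> {set 'I_n}} -> 'I_r.+2 -> R) :
  (forall h k, 0 <= phi h k) ->
  'E_P[fun w => phi (history w) (tau w)]%E
  = (r.+2%:R^-1 * \sum_h weight q h * \sum_k phi h k)%:E.
Proof.
move=> phi0.
rewrite (expectation_finite P random_element_outcome (phi := fun z => phi z.1 z.2))//.
congr EFin; have -> : \sum_z law P outcome z * phi z.1 z.2
    = \sum_h \sum_k law P outcome (h, k) * phi h k.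
  by rewrite pair_bigA/=; apply: eq_bigr => -[].
rewrite mulr_sumr; apply: eq_bigr => h _.
rewrite mulrA mulr_sumr; apply: eq_bigr => k _.
by rewrite law_outcome [weight q h * _]mulrC.
Qed.

Lemma draws_history w t : (0 < t < r.+1)%N -> draws (history w) t = St t w.
Proof.
case: t => [//|t] /= tr.
by rewrite (drawsS (history w) (Ordinal (tr : (t < r)%N))) ffunE.
Qed.

Lemma expected_evaluations :
  ('E_P[fun w => (sarah_evaluations r.+1 St w)%:R]
  = (n%:R + r%:R * batch_size P0 S)%:E)%E.
Proof.
pose evals (h : {ffun 'I_r -> {set 'I_n}}) : R := n%:R + \sum_i #|h i|%:R.
have -> : (fun w => (sarah_evaluations r.+1 St w)%:R) = (fun w => evals (history w)).
  apply/funext => w; rewrite /sarah_evaluations /evals natrD natr_sum; congr (_ + _).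
  rewrite big_add1/= big_mkord.
  by apply: eq_bigr => i _; rewrite ffunE.
rewrite (expectation_outcome (phi := fun h _ => evals h)); last first.
  by move=> h _; apply: addr_ge0 => //; apply: sumr_ge0.
congr EFin.
have -> : \sum_h weight q h * \sum_(k : 'I_r.+2) evals h
        = r.+2%:R * \sum_h weight q h * evals h.
  rewrite mulr_sumr; apply: eq_bigr => h _.
  by rewrite sumr_const card_ord -[evals h *+ _]mulr_natl mulrCA.
rewrite mulKf ?pnatr_eq0//.
under eq_bigr do rewrite mulrDr.
have q1 := law_sum1 P0 S_rand.
rewrite big_split/= -mulr_suml weight_sum1// mul1r; congr (_ + _).
under eq_bigr do rewrite mulr_sumr.
rewrite exchange_big/= (eq_bigr (fun=> batch_size P0 S)) => [|i _].
  by rewrite sumr_const card_ord -[_ *+ r]mulr_natl.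
by rewrite (expectation_coordinate q1 i (fun A => #|A|%:R)) batch_sizeE.
Qed.

End OuterLoopLaw.

(** * Step size and loop length *)

Section Arithmetic.
Variable R : realType.
Implicit Types a c l e D u : R.

(** With [s = sqrt (1 + 4 a)] and [u = l eta], the claim is
    [(2 - u - s u) (2 - u + s u) >= 0]. *)
Lemma step_size_bound l a eta : 0 < l -> 0 <= a -> 0 < eta ->
  eta <= 2 / (l * (Num.sqrt (1 + 4 * a) + 1)) ->
  a * (l * eta) ^+ 2 <= 1 - l * eta.
Proof.
move=> l0 a0 eta0; set s := Num.sqrt _.
have s0 : 0 <= s := sqrtr_ge0 _.
have s2 : s ^+ 2 = 1 + 4 * a by rewrite sqr_sqrtr//; lra.
rewrite ler_pdivlMr; last by rewrite mulr_gt0//; lra.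
have u0 : 0 < l * eta by exact: mulr_gt0.
rewrite mulrA (mulrC eta); set u := l * eta in u0 * => us.
have := mulr_ge0 s0 (ltW u0) => su.
have : 0 <= (2 - u - s * u) * (2 - u + s * u) by apply: mulr_ge0; lra.
have -> : (2 - u - s * u) * (2 - u + s * u) = (2 - u) ^+ 2 - s ^+ 2 * u ^+ 2 by ring.
by rewrite s2; lra.
Qed.

(** The largest root of [M^2 = 4 c^2 (1 + 4 a M)]. *)
Definition loop_length_root a c : R :=
  (16 * a * c ^+ 2 + Num.sqrt (256 * a ^+ 2 * c ^+ 4 + 16 * c ^+ 2)) / 2.

Lemma loop_length_root_ge0 a c : 0 <= a -> 0 <= loop_length_root a c.
Proof.
move=> a0; apply: divr_ge0 => //; apply: addr_ge0; last exact: sqrtr_ge0.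
by rewrite mulr_ge0 ?sqr_ge0 ?mulr_ge0.
Qed.

(** Since the square root [s] is at least 1, it is enough that [2 c s <= x], whose
    square is [4 c^2 (1 + 4 a x) <= x^2]; beyond the root [M] the quadratic
    [x^2 - 16 a c^2 x - 4 c^2] stays nonnegative because [16 a c^2 <= 2 M]. *)
Lemma loop_length_suffices a c x : 0 <= a -> 0 <= c -> loop_length_root a c <= x ->
  c * (Num.sqrt (1 + 4 * (a * x)) + 1) <= x + 1.
Proof.
move=> a0 c0; have := loop_length_root_ge0 c a0.
rewrite /loop_length_root; set t := Num.sqrt _; set M := _ / 2 => M0 Mx.
have t0 : 0 <= t := sqrtr_ge0 _.
have ac0 : 0 <= a * c ^+ 2 by rewrite mulr_ge0 ?sqr_ge0.
have t2 : t ^+ 2 = 256 * a ^+ 2 * c ^+ 4 + 16 * c ^+ 2.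
  by rewrite sqr_sqrtr// addr_ge0 ?mulr_ge0 ?sqr_ge0 ?exprn_ge0.
have M2 : M ^+ 2 = 4 * c ^+ 2 * (1 + 4 * (a * M)).
  by rewrite /M; nra.
have x0 : 0 <= x by exact: le_trans Mx.
have ax0 : 0 <= a * x by exact: mulr_ge0.
set s := Num.sqrt _.
have s1 : 1 <= s by rewrite -sqrtr1 ler_wsqrtr//; lra.
have s2 : s ^+ 2 = 1 + 4 * (a * x) by rewrite sqr_sqrtr//; lra.
have cs : 2 * c * s <= x.
  rewrite -ler_sqr ?nnegrE ?mulr_ge0//; last lra.
  have -> : (2 * c * s) ^+ 2 = 4 * c ^+ 2 * s ^+ 2 by ring.
  have := @mulr_ge0 _ (x - M) (x + M - 16 * (a * c ^+ 2)).
  rewrite s2; have -> : (x - M) * (x + M - 16 * (a * c ^+ 2))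
     = x ^+ 2 - M ^+ 2
       - (4 * c ^+ 2 * (4 * (a * x)) - 4 * c ^+ 2 * (4 * (a * M))) by ring.
  rewrite M2 => h; have {h} := h _ _; rewrite /M in Mx *; lra.
have := ler_wpM2l c0 s1; lra.
Qed.

Lemma loop_length_cost al b l e D : 0 < b -> 0 < e ->
  loop_length_root (al / b) (l * D / e) * b
  = 16 * al * l ^+ 2 * D ^+ 2 / (2 * e ^+ 2)
    + Num.sqrt (16 ^+ 2 * al ^+ 2 * l ^+ 4 * D ^+ 4
                + 16 * e ^+ 2 * l ^+ 2 * D ^+ 2 * b ^+ 2) / (2 * e ^+ 2).
Proof.
move=> b0 e0; rewrite /loop_length_root.
have [bn en] : b != 0 /\ e != 0 by rewrite !gt_eqF.
have be0 : 0 <= b * e ^+ 2 by rewrite mulr_ge0 ?exprn_ge0 ?ltW.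
set t := Num.sqrt (256 * _ * _ + _).
have -> : 16 ^+ 2 * al ^+ 2 * l ^+ 4 * D ^+ 4 + 16 * e ^+ 2 * l ^+ 2 * D ^+ 2 * b ^+ 2
  = (b * e ^+ 2) ^+ 2 * (256 * (al / b) ^+ 2 * (l * D / e) ^+ 4 + 16 * (l * D / e) ^+ 2).
  by field; rewrite bn en.
rewrite sqrtrM ?sqr_ge0// sqrtr_sqr ger0_norm// -/t.
by field; rewrite bn en.
Qed.

End Arithmetic.

(** * Guarantee and complexity of one outer loop *)

Section OuterLoop.
Variables (R : realType) (d n : nat).
Variables (f : 'I_n -> 'rV[R]_d -> R) (L : 'I_n -> R) (fmin : R).
Variables (disp0 : measure_display) (T0 : measurableType disp0).
Variables (P0 : probability T0 R) (S : T0 -> {set 'I_n}) (v : 'I_n -> R).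
Hypothesis f_diff : forall i x, differentiable (f i) x.
Hypothesis f_smooth : forall i, smooth_with (f i) (L i).
Hypothesis S_rand : random_element S.
Hypothesis S_proper : proper_sampling P0 S.
Hypothesis v_eso : eso_vector P0 S v.
Hypothesis L_gt0 : 0 < average L.

Local Notation F := (fun x => average (fun i => f i x)).
Local Notation p := (marginal P0 S).
Local Notation b := (batch_size P0 S).
Local Notation alpha := (sarah_alpha b p L v).

Hypothesis fmin_le : forall x, fmin <= F x.

Lemma batch_size_gt0 : 0 < b.
Proof.
rewrite batch_size_sum// lt_neqAle sumr_ge0 ?andbT => [|i _]; last exact/ltW/S_proper.
rewrite eq_sym psumr_neq0 => [|i _]; last exact/ltW/S_proper.
have [n0|n0] := posnP n.
  move: L_gt0; rewrite /average big1 ?mulr0 ?ltxx// => i _.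
  by have := ltn_ord i; rewrite [X in (_ < X)%N]n0.
by apply/hasP; exists (Ordinal n0); rewrite ?mem_index_enum ?S_proper.
Qed.

Lemma sarah_alphaE : alpha / b = eso_variance L P0 S v / average L ^+ 2.
Proof.
have b0 : b != 0 by rewrite gt_eqF// batch_size_gt0.
have l0 : average L != 0 by rewrite gt_eqF.
rewrite /sarah_alpha /sarah_K /eso_variance.
by set z := (n%:R ^+ 2)^-1; field; rewrite b0 l0.
Qed.

Lemma sarah_alpha_ge0 : 0 <= alpha / b.
Proof.
rewrite sarah_alphaE divr_ge0 ?sqr_ge0//.
exact: (eso_variance_ge0 L S_rand S_proper v_eso).
Qed.

Lemma expected_sq_gradient_output (r : nat) (eta : R) (x0 : 'rV[R]_d) :
  0 < eta ->
  eta <= 2 / (average L * (Num.sqrt (1 + 4 * alpha * r.+1%:R / b) + 1)) ->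
  forall (disp : measure_display) (T : measurableType disp)
    (P : probability T R) (St : nat -> T -> {set 'I_n}) (tau : T -> 'I_r.+2),
  sarah_randomness P0 S P St tau ->
  (expected_sq_gradient F P (sarah_output f p eta x0 St tau)
     <= (2 / (eta * (r.+1%:R + 1)) * (F x0 - fmin))%:E)%E.
Proof.
move=> eta0 eta_le disp T P St tau rnd.
pose phi (h : {ffun 'I_r -> {set 'I_n}}) (k : 'I_r.+2) :=
  enorm (gradient F (sarah_iterate f p eta x0 (draws h) k)) ^+ 2.
have -> : expected_sq_gradient F P (sarah_output f p eta x0 St tau)
  = 'E_P[fun w => phi (history r St w) (tau w)]%E.
  congr expectation; apply/funext => w; rewrite /phi /sarah_output.
  rewrite (@sarah_iterate_ext _ _ _ f p eta x0 _ (draws (history r St w)))//.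
  move=> t /andP[t0 tk].
  by rewrite draws_history// t0 (leq_trans tk)// -ltnS.
rewrite (expectation_outcome S_rand rnd (phi := phi)); last by move=> h k; exact: sqr_ge0.
have -> : 2 / (eta * (r.+1%:R + 1)) * (F x0 - fmin)
    = r.+2%:R^-1 * (2 / eta * (F x0 - fmin)) by rewrite natr1 invfM; ring.
rewrite lee_fin ler_wpM2l ?invr_ge0//.
apply: (expected_sum_sq_gradients f_diff f_smooth S_rand S_proper v_eso) => //.
have E : 4 * alpha * r.+1%:R / b = 4 * (r.+1%:R * (alpha / b)) by ring.
rewrite E in eta_le.
have := step_size_bound L_gt0 (mulr_ge0 (ler0n _ _) sarah_alpha_ge0) eta0 eta_le.
rewrite sarah_alphaE; apply: le_trans; rewrite le_eqVlt; apply/orP; left; apply/eqP.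
by field; rewrite gt_eqF.
Qed.

End OuterLoop.

Theorem theorem5 (R : realType) (d n : nat)
    (f : 'I_n -> 'rV[R]_d -> R) (L : 'I_n -> R) (x0 xstar : 'rV[R]_d)
    (disp0 : measure_display) (T0 : measurableType disp0)
    (P0 : probability T0 R) (S : T0 -> {set 'I_n}) (v : 'I_n -> R)
    (f_diff : forall i x, differentiable (f i) x)
    (f_smooth : forall i, smooth_with (f i) (L i))
    (xstar_min : forall x,
      average (fun i => f i xstar) <= average (fun i => f i x))
    (L_gt0 : 0 < average L)
    (S_rand : random_element S)
    (S_proper : proper_sampling P0 S)
    (v_eso : eso_vector P0 S v) :
  let F := fun x => average (fun i => f i x) in
  let Lbar := average L in
  let p := marginal P0 S in
  let b := batch_size P0 S in
  let alpha := sarah_alpha b p L v in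
  let Delta := F x0 - F xstar in
  let step_ok := fun (m : nat) (eta : R) =>
    0 < eta /\
    eta <= 2 / (Lbar * (Num.sqrt (1 + 4 * alpha * m%:R / b) + 1)) in
  (forall (m : nat) (eta : R), (0 < m)%N -> step_ok m eta ->
     forall (disp : measure_display) (T : measurableType disp)
       (P : probability T R) (St : nat -> T -> {set 'I_n})
       (tau : T -> 'I_m.+1),
     sarah_randomness P0 S P St tau ->
     (expected_sq_gradient F P (sarah_output f p eta x0 St tau)
        <= (2 / (eta * (m%:R + 1)) * Delta)%:E)%E)
  /\
  (forall eps : R, 0 < eps ->
     exists (m : nat) (eta : R),
       [/\ (0 < m)%N, step_ok m eta &
         forall (disp : measure_display) (T : measurableType disp)
           (P : probability T R) (St : nat -> T -> {set 'I_n})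
           (tau : T -> 'I_m.+1),
         sarah_randomness P0 S P St tau ->
         accurate F eps P (sarah_output f p eta x0 St tau) /\
         ('E_P[fun w => (sarah_evaluations m St w)%:R]
           <= (n%:R
               + 16 * alpha * Lbar ^+ 2 * Delta ^+ 2 / (2 * eps ^+ 2)
               + Num.sqrt (16 ^+ 2 * alpha ^+ 2 * Lbar ^+ 4 * Delta ^+ 4
                           + 16 * eps ^+ 2 * Lbar ^+ 2 * Delta ^+ 2 * b ^+ 2)
                 / (2 * eps ^+ 2))%:E)%E]).
Proof.
move=> F Lbar p b alpha Delta step_ok.
have b0 : 0 < b := batch_size_gt0 S_rand S_proper L_gt0.
have loop_bound (r : nat) (eta : R) (ok : step_ok r.+1 eta) := expected_sq_gradient_output
  f_diff f_smooth S_rand S_proper v_eso L_gt0 xstar_min x0 ok.1 ok.2.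
split=> [[//|r] eta _ ok disp T P St tau|eps eps0]; first exact: loop_bound.
have Delta0 : 0 <= Delta by rewrite subr_ge0; exact: xstar_min.
pose c := Lbar * Delta / eps.
have c0 : 0 <= c by apply: divr_ge0; [apply: mulr_ge0 => //|]; exact: ltW.
have a0 : 0 <= alpha / b := sarah_alpha_ge0 S_rand S_proper v_eso L_gt0.
pose M := loop_length_root (alpha / b) c.
have M0 : 0 <= M by exact: loop_length_root_ge0.
(* The loop length is [r.+1], and only [r] sets are drawn. *)
pose r := Num.truncn M.
have rM : r%:R <= M by rewrite truncn_le.
pose s := Num.sqrt (1 + 4 * alpha * r.+1%:R / b).
have s0 : 0 <= s := sqrtr_ge0 _.
pose eta := 2 / (Lbar * (s + 1)).
have ls0 : 0 < Lbar * (s + 1) by rewrite mulr_gt0// ltr_wpDl.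
have ok : step_ok r.+1 eta by split; [rewrite divr_gt0 | ].
exists r.+1, eta; split=> // disp T P St tau rnd; split.
  apply: le_trans (loop_bound _ _ ok _ _ _ _ _ rnd) _; rewrite lee_fin.
  have m0 : 0 < r.+1%:R + 1 :> R by rewrite ltr_wpDl.
  have -> : 2 / (eta * (r.+1%:R + 1)) * Delta = eps * (c * (s + 1)) / (r.+1%:R + 1).
    by rewrite /eta /c; field; rewrite !gt_eqF ?ltr_wpDl.
  rewrite ler_pdivrMr// ler_wpM2l ?(ltW eps0)//.
  have -> : s = Num.sqrt (1 + 4 * (alpha / b * r.+1%:R)).
    by congr (Num.sqrt (1 + _)); ring.
  exact: loop_length_suffices a0 c0 (ltW (truncnS_gt M)).
rewrite (expected_evaluations S_rand rnd) lee_fin -addrA lerD2l.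
by rewrite -loop_length_cost// ler_wpM2r ?(ltW b0).
Qed.
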